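(* Consider an irreducible continuous-time Markov chain on a finite set $V$ with generator $\mathscr L$, stationary probability $\pi$ and Donsker–Varadhan rate functional $\mathscr I$. Let $\nu:V\to\mathbb R$ satisfy $\sum_x\nu(x)=0$ and put $f=d\nu/d\pi$, i.e. $f(x)=\nu(x)/\pi(x)$. Then $$\frac{\delta^2\mathscr I}{\delta\mu^2}(\pi;\nu,\nu)=\sup_h\big\{2\langle f,h\rangle_\pi-\sigma^2(h)\big\},$$ where the supremum is over all functions $h:V\to\mathbb R$ with $\pi$-mean zero and $\sigma^2(h)=2\,\langle\mathscr L^{-1}h,(-\mathscr L^s)\mathscr L^{-1}h\rangle_\pi$.
   Context: With jump rates $R$, $(\mathscr Lf)(x)=\sum_yR(x,y)[f(y)-f(x)]$. $\langle f,g\rangle_\pi=\sum_x\pi(x)f(x)g(x)$; $\mathscr L^s=\frac12(\mathscr L+\mathscr L^* )$ with $\mathscr L^*$ the adjoint of $\mathscr L$ in $L^2(\pi)$. For $h$ with $\pi$-mean zero, $\mathscr L^{-1}h$ is the $\pi$-mean-zero solution $g$ of $\mathscr Lg=h$. ($\sigma^2(h)$ is the asymptotic variance in the central limit theorem for $t^{-1/2}\int_0^th(X_s)\,ds$ under $\pi$.) For a probability measure $\mu$ on $V$, $\mathscr I(\mu)=\sup_{u:V\to(0,\infty)}-\sum_x\mu(x)(\mathscr Lu)(x)/u(x)$. For $\mu$ strictly positive and $\nu,\nu_1,\nu_2:V\to\mathbb R$ of total mass $0$: $\frac{\delta\mathscr I}{\delta\mu}(\mu;\nu)=\lim_{\epsilon\to0}\frac1\epsilon\{\mathscr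 I(\mu+\epsilon\nu)-\mathscr I(\mu)\}$ and $\frac{\delta^2\mathscr I}{\delta\mu^2}(\mu;\nu_1,\nu_2)=\lim_{\epsilon\to0}\frac1\epsilon\{\frac{\delta\mathscr I}{\delta\mu}(\mu+\epsilon\nu_2;\nu_1)-\frac{\delta\mathscr I}{\delta\mu}(\mu;\nu_1)\}$. *)

(* Defs.v *)
From HB Require Import structures.
From mathcomp Require Import all_boot all_order all_algebra.
From mathcomp Require Import all_classical all_reals all_analysis.

Set Implicit Arguments.
Unset Strict Implicit.
Unset Printing Implicit Defensive.

Import Order.TTheory GRing.Theory Num.Theory.
Import numFieldNormedType.Exports.

Local Open Scope classical_set_scope.
Local Open Scope ring_scope.

Section MarkovChain.
Context {R : realType} {V : finType}.
Implicit Types (rate : V -> V -> R) (pi mu nu f g h u : V -> R).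

(* The diagonal of [rate] is unconstrained and irrelevant: it does not
   contribute to [generator]. *)
Definition jump_rates rate : Prop := forall x y, x != y -> 0 <= rate x y.

Definition irreducible rate : Prop :=
  forall x y, connect [rel a b | 0 < rate a b] x y.

Definition generator rate f : V -> R :=
  fun x => \sum_y rate x y * (f y - f x).

(* Measures on [V] are identified with their mass functions. *)
Definition probability_mass mu : Prop :=
  (forall x, 0 <= mu x) /\ \sum_x mu x = 1.

Definition stationary rate pi : Prop :=
  probability_mass pi /\
  forall f, \sum_x pi x * generator rate f x = 0.

Definition dotp pi f g : R := \sum_x pi x * f x * g x.

Definition mean_zero pi h : Prop := \sum_x pi x * h x = 0.

Definition is_adjoint pi (A B : (V -> R) -> (V -> R)) : Prop :=
  forall f g, dotp pi (A f) g = dotp pi f (B g).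

(* [xget d P] is an element of [P], and [d] if [P] is empty. When [pi] is
   strictly positive and [A] is linear, the adjoint exists and is unique. *)
Definition adjoint pi (A : (V -> R) -> (V -> R)) : (V -> R) -> (V -> R) :=
  xget (fun _ _ => 0) [set B | is_adjoint pi A B].

Definition sym_generator rate pi f : V -> R :=
  fun x => 2^-1 * (generator rate f x + adjoint pi (generator rate) f x).

(* Only used for mean-zero [h]; for an irreducible chain with stationary [pi]
   the solution then exists and is unique. *)
Definition inv_generator rate pi h : V -> R :=
  xget (fun _ => 0) [set g | mean_zero pi g /\ generator rate g = h].

Definition asymptotic_variance rate pi h : R :=
  let g := inv_generator rate pi h in
  2 * dotp pi g (fun x => - sym_generator rate pi g x).

(* The Donsker-Varadhan functional, as a supremum in the extended reals. *)
Definition DV rate mu : \bar R :=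
  ereal_sup [set (- \sum_x mu x * generator rate u x / u x)%:E
            | u in [set u | forall x, 0 < u x]].

Definition perturb mu (e : R) nu : V -> R := fun x => mu x + e * nu x.

(* The limit exists and is the real number [l]. The difference quotient is
   extended-real valued, so that convergence to a real number forces
   [DV rate mu] to be finite, and [DV rate (perturb mu e nu)] as well for
   small [e]. *)
Definition is_first_variation rate mu nu (l : R) : Prop :=
  ((e^-1)%:E * (DV rate (perturb mu e nu) - DV rate mu))%E
    @[e --> (0 : R)^'] --> l%:E.

(* [D e] is the first variation at [perturb mu e nu2] in the direction [nu1];
   it is required to exist for all [e] in a neighbourhood of 0, 0 included. *)
Definition is_second_variation rate mu nu1 nu2 (l : R) : Prop :=
  exists2 D : R -> R,
    \forall e \near (0 : R),
      is_first_variation rate (perturb mu e nu2) nu1 (D e) &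
    e^-1 * (D e - D 0) @[e --> (0 : R)^'] --> l.

End MarkovChain.

(* Main.v *)
Require Import Defs.
From HB Require Import structures.
From mathcomp Require Import all_boot all_order all_algebra.
From mathcomp Require Import all_classical all_reals all_analysis.
From mathcomp Require Import ring lra.

(* Writing u = exp g, the functional is I(mu) = sup_g J(mu, g), with J linear in
   mu and concave in g. For mu > 0, irreducibility makes J coercive modulo
   constants, so a maximizer g_mu exists. Strong concavity of J shows that the
   maximizers g_e at pi + e nu are Lipschitz in e, and the envelope argument then
   gives J(nu, g_e) as first variation at pi + e nu. Since g_0 = 0, expanding the
   first-order condition satisfied by g_e, tested against the Riesz representative
   psi of h |-> - <f, L h> for the Dirichlet form E, gives
   J(nu, g_e) = e E(psi, psi) + O(e^2). With h = L g, the right-hand side of the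
   theorem is sup_g (E(psi, psi) - E(psi + g, psi + g)) = E(psi, psi). *)

Set Implicit Arguments.
Unset Strict Implicit.
Unset Printing Implicit Defensive.

Import Order.TTheory GRing.Theory Num.Theory.
Import numFieldNormedType.Exports.

Local Open Scope classical_set_scope.
Local Open Scope ring_scope.

(** * Induction along paths and solvability of injective square systems *)

Lemma connect_backward_ind (T : finType) (e : rel T) (P : T -> Prop) :
  (forall a b, e a b -> P b -> P a) ->
  forall a b, connect e a b -> P b -> P a.
Proof.
move=> eP a b /connectP[p]; elim: p a => [a _ ->//|c p IHp a /= /andP[eac pp]].
by move=> bE /(IHp _ pp bE); exact: eP.
Qed.

Lemma injective_system_solvable (K : fieldType) (T : finType)
    (A : T -> T -> K) :
  (forall g, (forall x, \sum_y A x y * g y = 0) -> forall x, g x = 0) ->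
  forall k, exists g, forall x, \sum_y A x y * g y = k x.
Proof.
move=> Ainj k.
(* The transpose of [A], because [inj_row_free] concerns row vectors multiplied on the left of the
   matrix. *)
pose M := \matrix_(i < #|T|, j < #|T|) A (enum_val j) (enum_val i).
have MA (v : 'rV_#|T|) x :
    (v *m M) 0 (enum_rank x) = \sum_y A x y * v 0 (enum_rank y).
  rewrite mxE (reindex _ (onW_bij _ (enum_rank_bij T))) /=.
  by apply: eq_bigr => y _; rewrite mxE !enum_rankK mulrC.
have M_unit : M \in unitmx.
  rewrite -row_free_unit; apply: inj_row_free => v vM0.
  apply/rowP => i; rewrite mxE -(enum_valK i).
  apply: (Ainj (fun y => v 0 (enum_rank y))) => x.
  by rewrite -MA vM0 mxE.
pose v := (\row_i k (enum_val i)) *m invmx M.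
exists (fun y => v 0 (enum_rank y)) => x.
by rewrite -MA /v mulmxKV // mxE enum_rankK.
Qed.

(** * Algebra of the generator and positivity of the stationary law *)

Section Generator.
Context {R : realType} {V : finType}.
Implicit Types (r rate : V -> V -> R) (pi m f g h k : V -> R).

Lemma sum_generator rate m k g :
  \sum_x m x * k x * generator rate g x =
  \sum_p m p.1 * rate p.1 p.2 * (k p.1 * (g p.2 - g p.1)).
Proof.
rewrite -(pair_bigA _
  (fun x y => m x * rate x y * (k x * (g y - g x)))) /=.
apply: eq_bigr => x _; rewrite /generator mulr_sumr.
by apply: eq_bigr => y _; ring.
Qed.

Lemma sum_generator1 rate m g :
  \sum_x m x * generator rate g x =
  \sum_p m p.1 * rate p.1 p.2 * (g p.2 - g p.1).
Proof.
transitivity (\sum_x m x * 1 * generator rate g x).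
  by apply: eq_bigr => x _; rewrite mulr1.
by rewrite sum_generator; apply: eq_bigr => p _; rewrite mul1r.
Qed.

Lemma generatorB rate f g :
  generator rate (fun x => f x - g x) =
  (fun x => generator rate f x - generator rate g x).
Proof.
apply/funext => x; rewrite /generator -sumrB.
by apply: eq_bigr => y _; ring.
Qed.

Lemma generatorDrate r rate g :
  generator (fun x y => r x y + rate x y) g =
  (fun x => generator r g x + generator rate g x).
Proof.
apply/funext => x; rewrite /generator -big_split /=.
by apply: eq_bigr => y _; ring.
Qed.

(** Zeros of [pi] spread backwards along edges. If [pi b = 0], stationarity tested on the indicator
    of [b] is a vanishing sum of nonnegative terms, and the term at [a] contains [pi a * rate a b].
    By irreducibility one zero would make [pi] vanish everywhere, against total mass 1. *)
Lemma stationary_gt0 rate pi : (forall x y, 0 <= rate x y) ->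
  irreducible rate -> stationary rate pi -> forall x, 0 < pi x.
Proof.
move=> rate0 irr [[pi0 pi1] stat] x.
rewrite lt_neqAle pi0 andbT eq_sym; apply/eqP => pix0.
suff all0 y : pi y = 0.
  by move: pi1; rewrite big1 // => /esym/eqP; rewrite oner_eq0.
apply: (connect_backward_ind (P := fun z => pi z = 0) _ (irr y x)) => //.
move=> a b /= rab pib0; have [->//|aDb] := eqVneq a b.
pose d z : R := (z == b)%:R.
have gen_ge0 c : c != b -> 0 <= generator rate d c.
  move=> cDb; apply: sumr_ge0 => z _; apply: mulr_ge0 => //.
  by rewrite /d (negbTE cDb) subr0 ler0n.
have := stat d => /psumr_eq0P => /(_ _ a erefl) H.
have {H} : pi a * generator rate d a = 0.
  apply: H => c _; have [->|cDb] := eqVneq c b; first by rewrite pib0 mul0r.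
  by rewrite mulr_ge0 ?gen_ge0.
move/eqP; rewrite mulf_eq0 => /orP[/eqP//|].
rewrite gt_eqF // /generator (bigD1 b) //= ltr_wpDr //.
  apply: sumr_ge0 => z zDb; apply: mulr_ge0 => //.
  by rewrite /d (negbTE aDb) subr0 ler0n.
by rewrite /d eqxx (negbTE aDb) subr0 mulr1.
Qed.

Lemma irreducible_constant rate g : irreducible rate ->
  (forall a b, 0 < rate a b -> g a = g b) -> forall x y, g x = g y.
Proof.
move=> irr gE x y.
by apply: (connect_backward_ind (P := fun z => g z = g y) _ (irr x y)) =>
  // a b /gE ->.
Qed.

Lemma sub_irreducible r rate :
  (forall x y, x != y -> 0 < r x y -> 0 < rate x y) ->
  irreducible r -> irreducible rate.
Proof.
move=> sub irr x y; apply: (connect_sub _ (irr x y)) => a b /= rab.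
have [->|aDb] := eqVneq a b; first exact: connect0.
by apply: connect1; exact: sub.
Qed.

(** Twice the usual Dirichlet form, so that the asymptotic variance of [generator rate g] is
    [dirichlet rate pi g g] with no constant. It is symmetric in [f] and [g] even when the chain is
    not reversible. *)
Definition dirichlet rate pi f g :=
  \sum_p pi p.1 * rate p.1 p.2 * ((f p.2 - f p.1) * (g p.2 - g p.1)).

Lemma dirichletD rate pi f g :
  dirichlet rate pi (fun x => f x + g x) (fun x => f x + g x) =
  dirichlet rate pi f f + 2 * dirichlet rate pi f g + dirichlet rate pi g g.
Proof.
rewrite /dirichlet mulr_sumr -!big_split /=.
by apply: eq_bigr => p _; ring.
Qed.

Lemma dotpC pi f g : dotp pi f g = dotp pi g f.
Proof. by apply: eq_bigr => x _; ring. Qed.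

(** * Dirichlet form, Poisson equation and adjoint under a stationary law *)

Section Stationary.
Context (rate : V -> V -> R) (pi : V -> R)
  (rate0 : forall x y, 0 <= rate x y) (irr : irreducible rate)
  (stat : stationary rate pi).

Let pi_gt0 := stationary_gt0 rate0 irr stat.

(** Integrated carré du champ identity: L(fg) - f Lg - g Lf is the sum over jumps of products of
    increments, and L(fg) has mean zero by stationarity. *)
Lemma dirichletE f g : dirichlet rate pi f g =
  - (dotp pi f (generator rate g) + dotp pi g (generator rate f)).
Proof.
have := stat.2 (fun x => f x * g x); rewrite sum_generator1.
rewrite /dotp !sum_generator => H.
rewrite -[LHS]subr0 -[X in _ - X]H /dirichlet -big_split -!sumrN -big_split /=.
by apply: eq_bigr => p _; ring.
Qed.

Lemma dirichlet_ge0 g : 0 <= dirichlet rate pi g g.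
Proof.
apply: sumr_ge0 => p _; rewrite -expr2 mulr_ge0 ?sqr_ge0 //.
by rewrite mulr_ge0 // ltW.
Qed.

Lemma dirichlet_eq0 g :
  dirichlet rate pi g g = 0 -> forall x y, g x = g y.
Proof.
move=> /psumr_eq0P H; apply: (irreducible_constant irr) => a b rab.
have {H} /eqP : pi a * rate a b * ((g b - g a) * (g b - g a)) = 0.
  apply: (H _ (a, b)) => // p _.
  by rewrite -expr2 mulr_ge0 ?sqr_ge0 // mulr_ge0 // ltW.
rewrite -expr2 !mulf_eq0 (gt_eqF (pi_gt0 a)) (gt_eqF rab) /=.
by rewrite orbb subr_eq0 => /eqP.
Qed.

Lemma generator_eq0_const g : generator rate g = (fun=> 0) ->
  forall x y, g x = g y.
Proof.
move=> g0; apply: dirichlet_eq0; rewrite dirichletE g0 /dotp big1 ?addr0 ?oppr0 //.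
by move=> x _; rewrite mulr0.
Qed.

Lemma generator_mean_zero g : mean_zero pi (generator rate g).
Proof. exact: stat.2. Qed.

Lemma generator_solvable h : mean_zero pi h ->
  exists g, mean_zero pi g /\ generator rate g = h.
Proof.
move=> h0; have [[_ pi1] _] := stat.
(* L kills constants; adding the rank-one operator that sends [g] to its mean makes it injective and
   leaves the equation unchanged for mean-zero [g]. *)
pose A x y := rate x y - (y == x)%:R * (\sum_z rate x z) + pi y.
have AE g x : \sum_y A x y * g y = generator rate g x + \sum_y pi y * g y.
  transitivity (\sum_y (rate x y * g y - (\sum_z rate x z) * ((y == x)%:R * g y)
                        + pi y * g y)).
    by apply: eq_bigr => y _; rewrite /A; ring.
  rewrite big_split /= sumrB -mulr_sumr; congr (_ + _).
  have -> : \sum_y (y == x)%:R * g y = g x.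
    rewrite (bigD1 x) //= eqxx mul1r big1 ?addr0 // => y /negbTE ->.
    by rewrite mul0r.
  by rewrite mulr_suml -sumrB; apply: eq_bigr => y _; ring.
(* Pairing with [pi] kills the generator, so the two summands of [AE] can be
   separated. *)
have mean g c : (forall x, generator rate g x + \sum_y pi y * g y = c x) ->
    mean_zero pi c -> mean_zero pi g /\ generator rate g = c.
  move=> gc c0.
  have g0 : mean_zero pi g.
    rewrite /mean_zero; set s := \sum_x _; transitivity (\sum_x pi x * c x) => //.
    transitivity (\sum_x pi x * generator rate g x + \sum_x pi x * s).
      by rewrite [X in X + _](generator_mean_zero g) add0r -mulr_suml pi1 mul1r.
    by rewrite -big_split; apply: eq_bigr => x _; rewrite -gc mulrDr.
  by split=> //; apply/funext => x; rewrite -gc [X in _ + X]g0 addr0.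
have [g gE] : exists g, forall x, \sum_y A x y * g y = h x.
  apply: injective_system_solvable => g Ag0 x.
  have zero_mean : mean_zero pi (fun=> 0) by apply: big1 => y _; rewrite mulr0.
  have [y|g0 /generator_eq0_const gC] := mean g (fun=> 0) _ zero_mean.
    by rewrite -AE.
  rewrite -[LHS]mul1r -pi1 mulr_suml -[RHS]g0.
  by apply: eq_bigr => y _; rewrite (gC x y).
by exists g; apply: mean => // x; rewrite -AE.
Qed.

Lemma inv_generatorP h : mean_zero pi h ->
  mean_zero pi (inv_generator rate pi h) /\
  generator rate (inv_generator rate pi h) = h.
Proof. by move=> /generator_solvable gE; apply: (xgetPex _ gE). Qed.

Definition reversed_rate x y : R := pi y * rate y x / pi x.

Lemma reversed_generator_adjoint :
  is_adjoint pi (generator rate) (generator reversed_rate).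
Proof.
move=> f g; rewrite dotpC /dotp !sum_generator.
have := stat.2 (fun x => f x * g x); rewrite sum_generator1 => H.
(* Subtracting the stationarity identity for [f * g] moves the increment from [f] to [g]; exchanging
   the endpoints of each edge then produces the reversed rates. *)
pose F (p : V * V) := pi p.1 * rate p.1 p.2 * (f p.2 * (g p.1 - g p.2)).
transitivity (\sum_p F p).
  rewrite -[RHS]addr0 -[X in _ + X]H -big_split /=.
  by apply: eq_bigr => p _; rewrite /F; ring.
have swap_inj : injective (fun p : V * V => (p.2, p.1)).
  by move=> [a b] [c d] [-> ->].
rewrite (reindex_inj swap_inj) /=.
apply: eq_bigr => -[x y] _; rewrite /F /reversed_rate /=.
have := gt_eqF (pi_gt0 x) => /negbT pix.
by field.
Qed.

Lemma adjointP : is_adjoint pi (generator rate) (adjoint pi (generator rate)).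
Proof.
apply: (xgetPex _ (P := [set B | is_adjoint pi (generator rate) B])).
exists (generator reversed_rate); exact: reversed_generator_adjoint.
Qed.

Lemma asymptotic_varianceE h : mean_zero pi h ->
  asymptotic_variance rate pi h =
  dirichlet rate pi (inv_generator rate pi h) (inv_generator rate pi h).
Proof.
rewrite /asymptotic_variance; set g := inv_generator _ _ _ => _.
have := adjointP g g; rewrite dirichletE dotpC => gE.
rewrite {2}gE /dotp -big_split /= mulr_sumr -sumrN.
apply: eq_bigr => x _; rewrite /sym_generator.
by rewrite [in LHS]mulrN mulrN; congr (- _); field.
Qed.

(** The generator here is L + L*. The new part L* g has mean <1, L* g> = <L 1, g> = 0. *)
Lemma stationary_symmetrized :
  stationary (fun x y => rate x y + reversed_rate x y) pi.
Proof.
split=> [|g]; first exact: stat.1.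
under eq_bigr do rewrite generatorDrate mulrDr.
rewrite big_split /= [X in X + _](stat.2 g) add0r.
have := reversed_generator_adjoint (fun=> 1) g.
rewrite /dotp => /esym H.
transitivity (\sum_x pi x * 1 * generator reversed_rate g x).
  by apply: eq_bigr => x _; rewrite mulr1.
rewrite H big1 // => x _; rewrite /generator [X in _ * X * _]big1 ?mulr0 ?mul0r //.
by move=> y _; rewrite subrr mulr0.
Qed.

End Stationary.

Lemma dirichlet_representation rate pi (nu : V -> R) :
  (forall x y, 0 <= rate x y) -> irreducible rate -> stationary rate pi ->
  exists psi, forall g,
    dirichlet rate pi psi g = - \sum_x nu x * generator rate g x.
Proof.
move=> rate0 irr stat; have pi0 := stationary_gt0 rate0 irr stat.
pose r x y := rate x y + reversed_rate rate pi x y.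
have rev0 x y : 0 <= reversed_rate rate pi x y.
  by rewrite !mulr_ge0 ?invr_ge0 ?(ltW (pi0 _)).
have adj := reversed_generator_adjoint rate0 irr stat.
have rstat : stationary r pi by exact: stationary_symmetrized.
have rirr : irreducible r.
  by apply: sub_irreducible irr => x y _ xy; rewrite ltr_wpDr.
pose f x := nu x / pi x.
have fmean : mean_zero pi (generator (reversed_rate rate pi) f).
  have := rstat.2 f; under eq_bigr do rewrite generatorDrate mulrDr.
  by rewrite big_split /= [X in X + _](stat.2 f) add0r.
have [|psi [_ psiE]] := generator_solvable _ rirr rstat fmean.
  by move=> x y; rewrite addr_ge0.
exists psi => g; rewrite dirichletE //.
have -> : \sum_x nu x * generator rate g x = dotp pi (generator rate g) f.
  apply: eq_bigr => x _; rewrite /f mulrAC mulrCA divff ?mulr1 //.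
  by rewrite gt_eqF.
rewrite adj -psiE dotpC adj /r generatorDrate /dotp -big_split /=.
by congr (- _); apply: eq_bigr => x _; ring.
Qed.

End Generator.

(** * Elementary inequalities for the exponential *)

Section ExpBounds.
Context {R : realType}.
Implicit Types a b d M : R.

Lemma expR_tangent a b : expR b * (a - b) <= expR a - expR b.
Proof.
have := expR_ge1Dx (a - b); rewrite expRD expRN => H.
have eb := expR_gt0 b.
rewrite -(ler_pM2l eb) in H.
rewrite [X in _ <= X]mulrCA divff ?mulr1 ?gt_eqF // in H.
lra.
Qed.

Lemma expR_lipschitz a b M : a <= M -> b <= M ->
  `|expR a - expR b| <= expR M * `|a - b|.
Proof.
wlog ba : a b / b <= a => [H aM bM|aM bM].
  case: (leP b a) => [ba|/ltW ab]; first exact: H.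
  by rewrite distrC [X in _ * X]distrC; exact: H.
rewrite !ger0_norm ?subr_ge0 ?ler_expR //.
have := expR_tangent b a; rewrite -opprB mulrN => H1.
have : expR a * (a - b) <= expR M * (a - b).
  by rewrite ler_wpM2r ?subr_ge0 ?ler_expR.
lra.
Qed.

Lemma expR_taylor2_ge0 d : 0 <= expR d - 1 - d.
Proof. by have := expR_ge1Dx d; lra. Qed.

(** The tangent at [d], evaluated at 0, bounds the remainder by [d * (expR d - 1)]; the Lipschitz
    bound supplies the second factor [d]. *)
Lemma expR_taylor2_le d M : `|d| <= M -> expR d - 1 - d <= expR M * d ^+ 2.
Proof.
move=> dM.
have dM' : d <= M := le_trans (ler_norm d) dM.
have M0 : 0 <= M := le_trans (normr_ge0 d) dM.
have := expR_tangent 0 d; rewrite sub0r mulrN expR0 => H1.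
have := expR_lipschitz dM' M0; rewrite expR0 subr0 => H2.
have H3 : d * (expR d - 1) <= `|d| * (expR M * `|d|).
  by apply: le_trans (ler_norm _) _; rewrite normrM ler_wpM2l.
have -> : d ^+ 2 = `|d| * `|d| by rewrite -normrM ger0_norm // -expr2 sqr_ge0.
rewrite mulrCA in H3; lra.
Qed.

(** Strong convexity: the midpoint defect is the perfect square of [expR (a / 2) - expR (b / 2)],
    bounded below by the tangent at the smaller point. *)
Lemma expR_midpoint a b M : - M <= a -> - M <= b ->
  expR (- M) / 4 * (a - b) ^+ 2 <= expR a + expR b - 2 * expR ((a + b) / 2).
Proof.
wlog ba : a b / b <= a => [H aM bM|aM bM].
  case: (leP b a) => [ba|/ltW ab]; first exact: H.
  rewrite -sqrrN opprB (addrC a b) (addrC (expR a)); exact: H.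
have -> : expR a + expR b - 2 * expR ((a + b) / 2) =
    (expR (a / 2) - expR (b / 2)) ^+ 2.
  have half x : expR x = expR (x / 2) ^+ 2 :> R by rewrite expr2 -expRD -splitr.
  by rewrite (half a) (half b) [(a + b) / 2]mulrDl expRD; ring.
have H := expR_tangent (a / 2) (b / 2).
have H0 : 0 <= expR (b / 2) * (a / 2 - b / 2).
  by rewrite mulr_ge0 ?expR_ge0 //; lra.
have : (expR (b / 2) * (a / 2 - b / 2)) ^+ 2 <= (expR (a / 2) - expR (b / 2)) ^+ 2.
  by rewrite lerXn2r // nnegrE // (le_trans H0).
apply: le_trans.
have -> : (expR (b / 2) * (a / 2 - b / 2)) ^+ 2 = expR b / 4 * (a - b) ^+ 2.
  by rewrite [in RHS](splitr b) expRD; field.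
by rewrite ler_wpM2r ?sqr_ge0 // ler_pM2r ?invr_gt0 // ler_expR.
Qed.

Lemma linear_term_eq0 (A B : R) : 0 <= B ->
  (forall t, `|t| <= 1 -> 0 <= t * A + t ^+ 2 * B) -> A = 0.
Proof.
(* The test value is [t = - A / k]: [k >= |A|] keeps it in the allowed range, and [k > B] lets the
   linear term dominate. *)
move=> B0 H; pose k := 1 + `|A| + B.
have k0 : 0 < k by rewrite /k; have := normr_ge0 A; lra.
have := H (- A / k); rewrite normrM normrN normfV (gtr0_norm k0).
rewrite ler_pdivrMr // mul1r => /(_ _)/wrap[].
  by rewrite /k; lra.
have -> : - A / k * A + (- A / k) ^+ 2 * B = - (A ^+ 2 * (1 + `|A|) / k ^+ 2).
  have /negbT kN := gt_eqF k0.
  transitivity (A ^+ 2 * (B - k) / k ^+ 2); first by field.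
  have -> : B - k = - (1 + `|A|) by rewrite /k; ring.
  by rewrite mulrN mulNr.
rewrite oppr_ge0 pmulr_lle0 ?invr_gt0 ?exprn_gt0 // pmulr_lle0; last first.
  by have := normr_ge0 A; lra.
by move=> A2; apply/eqP; rewrite -sqrf_eq0 eq_le A2 sqr_ge0.
Qed.

End ExpBounds.

(** * The concave action: coercivity, maximizers and strong concavity *)

Section Action.
Context {R : realType} {V : finType}.
Implicit Types (rate : V -> V -> R) (m nu f g h : V -> R).

(* The Donsker-Varadhan functional is the supremum of this concave function of
   [g], by the substitution [u = expR g]. *)
Definition dv_action rate m g : R :=
  - \sum_p m p.1 * rate p.1 p.2 * (expR (g p.2 - g p.1) - 1).

Definition dv_maximizer rate m g : Prop :=
  forall g', dv_action rate m g' <= dv_action rate m g.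

Lemma dv_action0 rate m : dv_action rate m (fun=> 0) = 0.
Proof.
rewrite /dv_action big1 ?oppr0 // => p _.
by rewrite addr0 expR0 subrr mulr0.
Qed.

Lemma dv_action_perturb rate m e nu g :
  dv_action rate (perturb m e nu) g = dv_action rate m g + e * dv_action rate nu g.
Proof.
rewrite /dv_action /perturb mulrN mulr_sumr -opprD -big_split /=; congr (- _).
by apply: eq_bigr => p _; ring.
Qed.

Lemma DV_eq rate m g : dv_maximizer rate m g ->
  DV rate m = (dv_action rate m g)%:E.
Proof.
have actE h : - \sum_x m x * generator rate (fun x => expR (h x)) x / expR (h x)
    = dv_action rate m h.
  congr (- _); rewrite /generator -(pair_bigA _
    (fun x y => m x * rate x y * (expR (h y - h x) - 1))) /=.
  apply: eq_bigr => x _; rewrite -mulrA mulr_suml mulr_sumr.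
  apply: eq_bigr => y _; rewrite expRD expRN.
  have /negbT := gt_eqF (expR_gt0 (h x)) => hx.
  by field.
move=> gmax; apply/eqP; rewrite eq_le; apply/andP; split.
  apply: ge_ereal_sup => _ [u /= u0 <-]; rewrite lee_fin.
  have -> : u = (fun x => expR (ln (u x))).
    by apply/funext => x; rewrite lnK // posrE.
  by rewrite actE.
by apply: ereal_sup_ubound; exists (fun x => expR (g x));
  [move=> x; exact: expR_gt0|rewrite actE].
Qed.

(** A path without repetition has fewer than [#|V|] steps, each raising [g] by at most [K]. Paths
    exist in both directions, so the one-sided bound on edges becomes two-sided. *)
Lemma irreducible_osc_le rate g (K : R) : irreducible rate -> 0 <= K ->
  (forall a b, 0 < rate a b -> g b - g a <= K) ->
  forall x y, `|g y - g x| <= #|V|%:R * K.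
Proof.
move=> irr K0 gK.
have bound x y : g y - g x <= #|V|%:R * K.
  have /connectP[p0 + ->] := irr x y => /shortenP[p pp up _].
  have /= := max_card (mem (x :: p)); rewrite (card_uniqP up) /= => sp.
  apply: le_trans (_ : (size p)%:R * K <= _); last first.
    by rewrite ler_wpM2r // ler_nat ltnW.
  elim: p x pp {up sp} => [x _|z p IHp x /= /andP[xz /IHp]].
    by rewrite subrr mul0r.
  have := gK _ _ xz; rewrite -natr1; lra.
by move=> x y; rewrite ler_norml bound andbT lerNl opprB bound.
Qed.

(** A nonnegative action bounds the sum of [m * rate * expR] of the increments by the total jump
    weight, at most [T]. Hence increments along edges are bounded above. The bound [M] depends on
    [m] only through [a] and [C], hence is uniform along the perturbation. *)
Lemma dv_action_coercive rate (a C : R) :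
  (forall x y, 0 <= rate x y) -> irreducible rate -> 0 < a ->
  exists2 M : R, 0 <= M & forall m g, (forall x, a <= m x <= C) ->
    0 <= dv_action rate m g -> forall x y, `|g y - g x| <= M.
Proof.
move=> rate0 irr a0.
pose T := `|C| * \sum_p rate p.1 p.2.
(* The sum dominates the bound for each edge; pairs of zero rate contribute 0 since division by zero
   gives 0. *)
pose K := \sum_p T / (a * rate p.1 p.2).
have T0 : 0 <= T by rewrite mulr_ge0 // sumr_ge0.
have Kterm0 (p : V * V) : 0 <= T / (a * rate p.1 p.2).
  by rewrite divr_ge0 // mulr_ge0 // ltW.
have K0 : 0 <= K by rewrite sumr_ge0.
exists (#|V|%:R * K) => [|m g mb act0 x y]; first by rewrite mulr_ge0.
have m0 z : 0 <= m z by have /andP[+ _] := mb z; lra.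
apply: (irreducible_osc_le irr K0) => // b c rbc.
have bcT : m b * rate b c * expR (g c - g b) <= T.
  apply: (@le_trans _ _ (\sum_p m p.1 * rate p.1 p.2 * expR (g p.2 - g p.1))).
    rewrite (bigD1 (b, c)) //= lerDl sumr_ge0 // => p _.
    by rewrite !mulr_ge0 ?expR_ge0.
  apply: (@le_trans _ _ (\sum_p m p.1 * rate p.1 p.2)).
    move: act0; rewrite /dv_action oppr_ge0.
    under eq_bigr do rewrite mulrBr mulr1.
    by rewrite sumrB subr_le0.
  rewrite /T mulr_sumr; apply: ler_sum => p _; rewrite ler_wpM2r //.
  by have /andP[_ mC] := mb p.1; apply: le_trans mC (ler_norm _).
have : expR (g c - g b) <= T / (a * rate b c).
  rewrite ler_pdivlMr ?mulr_gt0 // mulrC; apply: le_trans bcT.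
  rewrite ler_wpM2r ?expR_ge0 // ler_wpM2r //.
  by have /andP[] := mb b.
have : T / (a * rate b c) <= K.
  by rewrite /K (bigD1 (b, c)) //= lerDl sumr_ge0.
have := expR_ge1Dx (g c - g b); lra.
Qed.

(** The action is continuous, hence has a maximum on the box of side given by coercivity. A
    competitor of negative action loses to 0; any other one enters the box once shifted to vanish at
    [x0], which leaves its action unchanged. *)
Lemma dv_maximizer_exists rate m (a C : R) :
  (forall x y, 0 <= rate x y) -> irreducible rate -> 0 < a ->
  (forall x, a <= m x <= C) -> exists g, dv_maximizer rate m g.
Proof.
move=> rate0 irr a0 mb.
have [M M0 bound] := dv_action_coercive C rate0 irr a0.
pose g_of (v : 'rV[R]_#|V|) x := v ord0 (enum_rank x).
pose A := [set v : 'rV[R]_#|V| | forall i, v ord0 i \in `[- M, M]].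
have A0 : A !=set0 by exists 0 => i /=; rewrite mxE in_itv /= oppr_le0 M0.
have Acompact : compact A.
  by apply: (@rV_compact _ _ (fun=> [set` `[- M, M]])) => i; exact: segment_compact.
have sum_cont : continuous (fun v : 'rV[R]_#|V| =>
    \sum_p m p.1 * rate p.1 p.2 * (expR (g_of v p.2 - g_of v p.1) - 1)).
  apply: (@continuous_big R _ +%R 0 xpredT); first exact: add_continuous.
  move=> p _.
  have g_cont x : continuous (fun v : 'rV[R]_#|V| => g_of v x).
    exact: coord_continuous.
  have exp_cont : continuous (fun v : 'rV[R]_#|V| => expR (g_of v p.2 - g_of v p.1)).
    move=> v; apply: (@continuous_comp _ _ _ (fun v => g_of v p.2 - g_of v p.1) expR).
      exact: cvgB (g_cont p.2 v) (g_cont p.1 v).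
    exact: continuous_expR.
  by move=> v; exact: cvgM (cvg_cst _) (cvgB (exp_cont v) (cvg_cst _)).
have cont : {within A, continuous (fun v => dv_action rate m (g_of v))}.
  by apply: continuous_subspaceT => v; exact: continuousN (sum_cont v).
have [v vA vmax] := compact_EVT_max A0 Acompact cont.
exists (g_of v) => g'.
have [x0 _|V0] := pickP (mem V); last first.
  suff -> : g' = g_of v by [].
  by apply/funext => x; have := V0 x.
have [neg|pos] := ltP (dv_action rate m g') 0.
  apply: le_trans (ltW neg) _; rewrite -(dv_action0 rate m).
  have -> : (fun=> 0 : R) = g_of 0 by apply/funext => x; rewrite /g_of mxE.
  by apply: vmax; rewrite inE => i /=; rewrite mxE in_itv /= oppr_le0 M0.
pose v' : 'rV[R]_#|V| := \row_i (g' (enum_val i) - g' x0).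
have -> : dv_action rate m g' = dv_action rate m (g_of v').
  congr (- _); apply: eq_bigr => p _; rewrite /g_of !mxE !enum_rankK.
  by congr (_ * (expR _ - _)); ring.
apply: vmax; rewrite inE => i /=; rewrite mxE in_itv /= -ler_norml.
exact: bound.
Qed.

(** The maximizer is compared with [g + t f]. The second-order Taylor bound, uniform for [|t| <= 1],
    leaves a linear term plus [t ^+ 2 * B], to which [linear_term_eq0] applies. *)
Lemma dv_maximizer_first_order rate m g f :
  (forall x y, 0 <= rate x y) -> (forall x, 0 <= m x) ->
  dv_maximizer rate m g ->
  \sum_p m p.1 * rate p.1 p.2 * (expR (g p.2 - g p.1) * (f p.2 - f p.1)) = 0.
Proof.
move=> rate0 m0 gmax; pose w (p : V * V) := m p.1 * rate p.1 p.2 * expR (g p.2 - g p.1).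
have w0 p : 0 <= w p by rewrite !mulr_ge0 ?expR_ge0.
pose B := \sum_p w p * (expR `|f p.2 - f p.1| * (f p.2 - f p.1) ^+ 2).
transitivity (\sum_p w p * (f p.2 - f p.1)).
  by apply: eq_bigr => p _; rewrite /w; ring.
apply: (@linear_term_eq0 _ _ B) => [|t t1].
  by apply: sumr_ge0 => p _; rewrite mulr_ge0 // mulr_ge0 ?expR_ge0 ?sqr_ge0.
have := gmax (fun x => g x + t * f x); rewrite lerN2 -subr_ge0 => /le_trans; apply.
rewrite -sumrB /B !mulr_sumr -big_split /=; apply: ler_sum => p _.
have -> : g p.2 + t * f p.2 - (g p.1 + t * f p.1) =
  (g p.2 - g p.1) + t * (f p.2 - f p.1) by ring.
rewrite expRD; set d := f p.2 - f p.1.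
have : w p * (expR (t * d) - 1 - t * d) <= w p * (expR `|d| * (t * d) ^+ 2).
  apply: ler_wpM2l => //; apply: expR_taylor2_le.
  by rewrite normrM ler_piMl.
rewrite /w exprMn; lra.
Qed.

(** Distances between gradients, because the action determines [g] only up to a constant. [edge_l2]
    below is not square-rooted. *)
Definition edge_l1 rate g g' : R :=
  \sum_p rate p.1 p.2 * `|(g p.2 - g p.1) - (g' p.2 - g' p.1)|.

Definition edge_l2 rate g g' : R :=
  \sum_p rate p.1 p.2 * ((g p.2 - g p.1) - (g' p.2 - g' p.1)) ^+ 2.

Lemma edge_l2C rate g g' : edge_l2 rate g g' = edge_l2 rate g' g.
Proof. by apply: eq_bigr => p _; rewrite -sqrrN opprB. Qed.

(** Young's inequality on each edge, with free parameter [u]. *)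
Lemma edge_l1_le_l2 rate g g' (t u : R) : (forall x y, 0 <= rate x y) -> 0 < u ->
  t * edge_l1 rate g g' <=
  u * edge_l2 rate g g' + t ^+ 2 / (4 * u) * \sum_p rate p.1 p.2.
Proof.
move=> rate0 u0; rewrite /edge_l1 /edge_l2 !mulr_sumr -big_split /=.
apply: ler_sum => p _; set d := _ - _ - _.
rewrite -(real_normK (num_real d)) mulrCA [X in _ <= X + _]mulrCA.
rewrite [X in _ <= _ + X]mulrC -mulrDr ler_wpM2l //.
rewrite -subr_ge0.
have -> : u * `|d| ^+ 2 + t ^+ 2 / (4 * u) - t * `|d| =
    u * (`|d| - t / (2 * u)) ^+ 2.
  by have /negbT := gt_eqF u0 => uN; field.
by rewrite mulr_ge0 ?sqr_ge0 // ltW.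
Qed.

(* Compare the maximum with the value at the midpoint of [g] and [g']. *)
Lemma dv_action_strong_concave rate m (a M : R) g g' :
  (forall x y, 0 <= rate x y) -> 0 <= a -> (forall x, a <= m x) ->
  (forall x y, `|g y - g x| <= M) -> (forall x y, `|g' y - g' x| <= M) ->
  dv_maximizer rate m g ->
  a * (expR (- M) / 4) * edge_l2 rate g g' <=
  dv_action rate m g - dv_action rate m g'.
Proof.
move=> rate0 a0 am gM g'M gmax.
pose h x := (g x + g' x) / 2.
suff H : a * (expR (- M) / 4) * edge_l2 rate g g' <=
    2 * dv_action rate m h - dv_action rate m g - dv_action rate m g'.
  by have := gmax h; lra.
rewrite /dv_action /edge_l2 mulrN !opprK !mulr_sumr -sumrN -!big_split /=.
apply: ler_sum => p _.
have lo (k : V -> R) x y : (forall x y, `|k y - k x| <= M) -> - M <= k y - k x.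
  by move=> /(_ x y); rewrite ler_norml => /andP[].
have mid := expR_midpoint (lo g p.1 p.2 gM) (lo g' p.1 p.2 g'M).
have -> : h p.2 - h p.1 = (g p.2 - g p.1 + (g' p.2 - g' p.1)) / 2.
  by rewrite /h; field.
set A := expR (g p.2 - g p.1) in mid *; set B := expR (g' p.2 - g' p.1) in mid *.
set H := expR (_ / 2) in mid *.
have -> : - (2 * (m p.1 * rate p.1 p.2 * (H - 1))) + m p.1 * rate p.1 p.2 * (A - 1)
  + m p.1 * rate p.1 p.2 * (B - 1) = m p.1 * (rate p.1 p.2 * (A + B - 2 * H)) by ring.
rewrite -mulrA mulrCA -mulrA.
have E0 : 0 <= expR (- M) / 4 * (g p.2 - g p.1 - (g' p.2 - g' p.1)) ^+ 2.
  by rewrite mulr_ge0 ?sqr_ge0 // divr_ge0 ?expR_ge0.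
have X : rate p.1 p.2 * (expR (- M) / 4 * (g p.2 - g p.1 - (g' p.2 - g' p.1)) ^+ 2)
  <= rate p.1 p.2 * (A + B - 2 * H) by rewrite ler_wpM2l.
apply: le_trans (_ : a * (rate p.1 p.2 * (A + B - 2 * H)) <= _).
  apply: le_trans (ler_wpM2l a0 X).
  by rewrite le_eqVlt; apply/orP; left; apply/eqP; ring.
by rewrite ler_wpM2r // (le_trans _ X) // mulr_ge0.
Qed.

Lemma dv_action_lipschitz rate nu (N M : R) g g' :
  (forall x y, 0 <= rate x y) -> (forall x, `|nu x| <= N) ->
  (forall x y, `|g y - g x| <= M) -> (forall x y, `|g' y - g' x| <= M) ->
  `|dv_action rate nu g - dv_action rate nu g'| <=
  N * expR M * edge_l1 rate g g'.
Proof.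
move=> rate0 nuN gM g'M.
rewrite /dv_action -opprD normrN -sumrB /edge_l1 mulr_sumr.
apply: le_trans (ler_norm_sum _ _ _) _; apply: ler_sum => p _.
have -> : nu p.1 * rate p.1 p.2 * (expR (g p.2 - g p.1) - 1)
  - nu p.1 * rate p.1 p.2 * (expR (g' p.2 - g' p.1) - 1) =
  nu p.1 * (rate p.1 p.2 * (expR (g p.2 - g p.1) - expR (g' p.2 - g' p.1))) by ring.
rewrite !normrM (ger0_norm (rate0 _ _)) -mulrA ler_pM ?mulr_ge0 //.
rewrite mulrCA ler_wpM2l // expR_lipschitz //.
  exact: le_trans (ler_norm _) (gM _ _).
exact: le_trans (ler_norm _) (g'M _ _).
Qed.

End Action.

(** * Limits at 0, and the variations of the functional along [pi + e nu] *)

Lemma cvg_dnbhs0_lipschitz (R : realType) (f : R -> R) (l C : R) :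
  (\forall t \near 0^', `|f t - l| <= C * `|t|) -> f t @[t --> 0^'] --> l.
Proof.
move=> fl; apply/cvgrPdist_le => eps eps0.
have C0 : 0 < 1 + `|C| by have := normr_ge0 C; lra.
near=> t; rewrite distrC.
have : `|t| <= eps / (1 + `|C|).
  by near: t; apply: dnbhs0_le; rewrite divr_gt0.
rewrite ler_pdivlMr // mulrC; apply: le_trans.
apply: (@le_trans _ _ (C * `|t|)); first by near: t.
by rewrite ler_wpM2r // (le_trans (ler_norm C)) // lerDr.
Unshelve. all: by end_near. Qed.

Section Perturbation.
Context {R : realType} {V : finType} (rate : V -> V -> R) (pi nu : V -> R)
  (rate0 : forall x y, 0 <= rate x y) (irr : irreducible rate)
  (stat : stationary rate pi).
Implicit Types (g psi : V -> R) (a d e C D M : R).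

Let pi_gt0 := stationary_gt0 rate0 irr stat.
Let total_nu : R := \sum_x `|nu x|.

Let nu_le x : `|nu x| <= total_nu.
Proof. by rewrite /total_nu (bigD1 x) //= lerDl sumr_ge0. Qed.

Let total_nu_ge0 : 0 <= total_nu.
Proof. by rewrite sumr_ge0. Qed.

Lemma perturb_bounds : exists a d, [/\ 0 < a, 0 < d &
  forall e, `|e| <= d -> forall x, a <= perturb pi e nu x <= 2].
Proof.
have [[_ pi1] _] := stat.
have [x0 _|V0] := pickP (mem V); last first.
  by move: pi1; rewrite big_pred0 ?(eq_sym 0) // => /esym/eqP; rewrite oner_eq0.
have [x1 _ x1min] := arg_minP pi (erefl : xpredT x0).
have pi_le1 x : pi x <= 1.
  by rewrite -pi1 (bigD1 x) //= lerDl sumr_ge0 // => y _; exact: ltW.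
have D0 : 0 < 1 + total_nu by have := total_nu_ge0; lra.
(* [pi x1] is the minimum of [pi], and the perturbation may use up half of it. The 1 in the
   denominator keeps it positive when [nu] is 0. *)
exists (pi x1 / 2), (pi x1 / 2 / (1 + total_nu)).
have a0 : 0 < pi x1 / 2 by have := pi_gt0 x1; lra.
split=> // [|e eD x]; first by rewrite divr_gt0.
have : `|e * nu x| <= pi x1 / 2.
  rewrite ler_pdivlMr // in eD; apply: le_trans eD.
  by rewrite normrM ler_wpM2l // (le_trans (nu_le x)) // lerDr ler01.
rewrite ler_norml /perturb => /andP[lo hi].
have := x1min x isT; have := pi_le1 x; have := pi_le1 x1; lra.
Qed.

Lemma dv_maximizer_ge0 m g : dv_maximizer rate m g -> 0 <= dv_action rate m g.
Proof. by move=> /(_ (fun=> 0)); rewrite dv_action0. Qed.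

(** Since exp x - 1 >= x, the action is at most minus its linear part, which vanishes by
    stationarity. *)
Lemma dv_maximizer_stationary : dv_maximizer rate pi (fun=> 0).
Proof.
move=> g; rewrite dv_action0 /dv_action oppr_le0.
have := stat.2 g; rewrite sum_generator1 => S0; rewrite -[X in X <= _]S0; apply: ler_sum => p _.
rewrite ler_wpM2l ?mulr_ge0 ?(ltW (pi_gt0 _)) //.
by have := expR_ge1Dx (g p.2 - g p.1); lra.
Qed.

(** Adding the two strong concavity inequalities gives 2 c q <= (e' - e)(b' - b), where [b] and [b']
    are the [nu]-actions. The right side is at most [s * (B * w)], and Young's inequality absorbs it
    into c q plus a multiple of s^2. A second use with [u = 1] gives the [edge_l1] bound, whence the
    extra [r / 4] in the constant. *)
Lemma dv_maximizer_stable a M : 0 < a -> exists2 C : R, 0 <= C &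
  forall e e' g g',
    (forall x, a <= perturb pi e nu x) -> (forall x, a <= perturb pi e' nu x) ->
    (forall x y, `|g y - g x| <= M) -> (forall x y, `|g' y - g' x| <= M) ->
    dv_maximizer rate (perturb pi e nu) g ->
    dv_maximizer rate (perturb pi e' nu) g' ->
    edge_l2 rate g g' <= C * (e' - e) ^+ 2 /\
    `|e' - e| * edge_l1 rate g g' <= C * (e' - e) ^+ 2.
Proof.
move=> a0; pose c := a * (expR (- M) / 4); pose B := total_nu * expR M.
pose r := \sum_p rate p.1 p.2.
have r0 : 0 <= r by rewrite sumr_ge0.
have c0 : 0 < c by rewrite mulr_gt0 // divr_gt0 ?expR_gt0.
have B0 : 0 <= B by rewrite mulr_ge0 ?expR_ge0.
have C0 : 0 <= B ^+ 2 * r / (4 * c ^+ 2).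
  by rewrite divr_ge0 // mulr_ge0 // sqr_ge0.
exists (B ^+ 2 * r / (4 * c ^+ 2) + r / 4).
  by rewrite addr_ge0 // divr_ge0.
move=> e e' g g' am am' gM g'M gmax g'max.
set s := `|e' - e|.
have s2 : (e' - e) ^+ 2 = s ^+ 2 by rewrite real_normK ?num_real.
have := dv_action_strong_concave rate0 (ltW a0) am gM g'M gmax.
have := dv_action_strong_concave rate0 (ltW a0) am' g'M gM g'max.
rewrite (edge_l2C rate g' g) !dv_action_perturb -/c.
set q := edge_l2 rate g g'; set w := edge_l1 rate g g'.
set b := dv_action rate nu g; set b' := dv_action rate nu g' => H1 H2.
have H3 : (e' - e) * (b' - b) <= s * (B * w).
  apply: le_trans (ler_norm _) _; rewrite normrM ler_wpM2l // distrC.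
  exact: dv_action_lipschitz.
have := edge_l1_le_l2 g g' (s * B) rate0 c0; rewrite -/q -/w -/r => H4.
have q_le : q <= B ^+ 2 * r / (4 * c ^+ 2) * s ^+ 2.
  rewrite -(ler_pM2l c0).
  have -> : c * (B ^+ 2 * r / (4 * c ^+ 2) * s ^+ 2) = (s * B) ^+ 2 / (4 * c) * r.
    by have /negbT := gt_eqF c0 => cN; field.
  lra.
have := edge_l1_le_l2 g g' s rate0 ltr01; rewrite -/q -/w -/r => H5.
have H6 : 0 <= r / 4 * s ^+ 2 by rewrite mulr_ge0 ?sqr_ge0 // divr_ge0.
rewrite s2; split; lra.
Qed.

Lemma perturb_maximizers : exists a d M, [/\ 0 < a, 0 < d,
  forall e, `|e| <= d -> forall x, a <= perturb pi e nu x <= 2,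
  forall e, `|e| <= d -> exists g, dv_maximizer rate (perturb pi e nu) g &
  forall e g, `|e| <= d -> dv_maximizer rate (perturb pi e nu) g ->
    forall x y, `|g y - g x| <= M].
Proof.
have [a [d [a0 d0 mb]]] := perturb_bounds.
have [M _ bound] := dv_action_coercive 2 rate0 irr a0.
exists a, d, M; split=> // e => [/mb|g /mb emb /dv_maximizer_ge0].
  exact: dv_maximizer_exists.
exact: bound.
Qed.

(* [b <= (F t - F 0) / t <= b'], where [b] and [b'] are the [nu]-actions of the
   two maximizers: insert each of them in the other variational problem. *)
Lemma DV_first_variation a d M e (G : R -> V -> R) : 0 < a ->
  (forall e, `|e| <= d -> forall x, a <= perturb pi e nu x <= 2) ->
  (forall e g, `|e| <= d -> dv_maximizer rate (perturb pi e nu) g ->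
    forall x y, `|g y - g x| <= M) ->
  (forall e, `|e| <= d -> dv_maximizer rate (perturb pi e nu) (G e)) ->
  `|e| < d ->
  is_first_variation rate (perturb pi e nu) nu (dv_action rate nu (G e)).
Proof.
move=> a0 mb bound Gmax ed.
have [C C0 stab] := dv_maximizer_stable M a0.
pose F t := dv_action rate (perturb pi t nu) (G t).
have ed' := ltW ed.
rewrite /is_first_variation.
apply: (@cvg_trans _ ((t^-1 * (F (e + t) - F e))%:E @[t --> (0 : R)^'])).
  apply: near_eq_cvg; near=> t.
  have -> : perturb (perturb pi e nu) t nu = perturb pi (e + t) nu.
    by apply/funext => x; rewrite /perturb; ring.
  rewrite (DV_eq (Gmax _ ed')) (DV_eq (g := G (e + t))) //.
  apply: Gmax; apply: le_trans (ler_normD _ _) _; rewrite -lerBrDl.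
  by near: t; apply: dnbhs0_le; rewrite subr_gt0.
apply: cvg_EFin; first by near=> t.
apply: (@cvg_dnbhs0_lipschitz _ _ _ (total_nu * expR M * C)); near=> t.
have etd : `|e + t| <= d.
  apply: le_trans (ler_normD _ _) _; rewrite -lerBrDl.
  by near: t; apply: dnbhs0_le; rewrite subr_gt0.
have t0 : t != 0 by near: t; exact: nbhs_dnbhs_neq.
have nt0 : 0 < `|t| by rewrite normr_gt0.
have lo x s : `|s| <= d -> a <= perturb pi s nu x by move=> /mb /(_ x) /andP[].
have [_] := stab _ _ _ _ (fun x => lo x _ ed') (fun x => lo x _ etd)
  (bound _ _ ed' (Gmax _ ed')) (bound _ _ etd (Gmax _ etd)) (Gmax _ ed') (Gmax _ etd).
have := dv_action_lipschitz rate0 nu_le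
  (bound _ _ ed' (Gmax _ ed')) (bound _ _ etd (Gmax _ etd)).
rewrite addrAC subrr add0r => lip stab1.
have := Gmax _ ed' (G (e + t)); have := Gmax _ etd (G e).
rewrite /F !dv_action_perturb => H1 H2.
set b := dv_action rate nu (G e) in lip H1 H2 *.
set b' := dv_action rate nu (G (e + t)) in lip H1 H2 *.
(* Kept multiplied by [t], the comparison 0 <= X - t b <= t (b' - b) holds for both signs of [t];
   Lipschitz continuity and stability make the right side O(t^2). *)
set X := _ + _ * b' - _.
have X1 : 0 <= X - t * b by rewrite /X; lra.
have X2 : X - t * b <= t * (b' - b) by rewrite /X; lra.
have -> : t^-1 * X - b = (X - t * b) / t by field.
rewrite normrM normfV ler_pdivrMr // (ger0_norm X1).
apply: le_trans X2 _; apply: le_trans (ler_norm _) _.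
rewrite normrM distrC mulrC.
have : `|b - b'| * `|t| <= total_nu * expR M * (`|t| * edge_l1 rate (G e) (G (e + t))).
  by rewrite (mulrC `|t|) mulrA ler_wpM2r.
move=> /le_trans; apply.
rewrite -!(mulrA (_ * expR M)) ler_wpM2l ?mulr_ge0 ?expR_ge0 //.
by rewrite -mulrA -expr2 real_normK ?num_real.
Unshelve. all: by end_near. Qed.

(** Representation by [psi] turns the linear part of the [nu]-action into E(psi, g), and the
    first-order condition makes this e E(psi, psi) up to errors. The term of [T] with a factor [e]
    is controlled by [edge_l1], the two with the Taylor remainder [r] by [edge_l2]. *)
Lemma dv_action_expansion a M C D psi e g :
  0 < a -> (forall x, a <= perturb pi e nu x <= 2) ->
  (forall x y, `|g y - g x| <= M) -> dv_maximizer rate (perturb pi e nu) g ->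
  (forall h, dirichlet rate pi psi h = - \sum_x nu x * generator rate h x) ->
  (forall x y, `|psi y - psi x| <= D) ->
  edge_l2 rate (fun=> 0) g <= C * e ^+ 2 ->
  `|e| * edge_l1 rate (fun=> 0) g <= C * e ^+ 2 ->
  `|dv_action rate nu g - e * dirichlet rate pi psi psi| <=
  (total_nu * D + (2 * D + total_nu) * expR M) * C * e ^+ 2.
Proof.
move=> a0 mb gM gmax psiE psiD l2 l1.
have m0 x : 0 <= perturb pi e nu x by have /andP[+ _] := mb x; lra.
have D0 : 0 <= D.
  have [x0 _|V0] := pickP (mem V); first exact: le_trans (psiD x0 x0).
  have [[_ +] _] := stat; rewrite big_pred0 // => /esym/eqP.
  by rewrite oner_eq0.
pose r (p : V * V) := expR (g p.2 - g p.1) - 1 - (g p.2 - g p.1).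
pose T (p : V * V) := e * nu p.1 * rate p.1 p.2 * (g p.2 - g p.1) * (psi p.2 - psi p.1)
  + perturb pi e nu p.1 * rate p.1 p.2 * r p * (psi p.2 - psi p.1)
  + nu p.1 * rate p.1 p.2 * r p.
(* First-order condition in the direction [psi], expanded at [g = 0]. *)
have -> : dv_action rate nu g - e * dirichlet rate pi psi psi = - \sum_p T p.
  have FO := dv_maximizer_first_order psi rate0 m0 gmax.
  have S0 := stat.2 psi; rewrite sum_generator1 in S0.
  have S2 := psiE g; rewrite sum_generator1 in S2.
  rewrite psiE sum_generator1; apply/eqP; rewrite -subr_eq0 opprK; apply/eqP.
  move/eqP: S2; rewrite -subr_eq0 opprK => /eqP S2.
  rewrite -[LHS]subr0 -[X in _ - X]FO -[LHS]addr0 -[X in _ + X = _]S0.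
  rewrite -[LHS]addr0 -[X in _ + X = _]S2.
  rewrite /dv_action /dirichlet mulrN opprK mulr_sumr -!sumrN -!big_split /=.
  by rewrite big1 // => p _; rewrite /T /r /perturb; ring.
rewrite normrN.
apply: (@le_trans _ _ (total_nu * D * (`|e| * edge_l1 rate (fun=> 0) g) +
    (2 * D + total_nu) * expR M * edge_l2 rate (fun=> 0) g)); last first.
  have := ler_wpM2l (mulr_ge0 total_nu_ge0 D0) l1.
  have K0 : 0 <= (2 * D + total_nu) * expR M.
    by rewrite mulr_ge0 ?expR_ge0 // addr_ge0 // mulr_ge0.
  have := ler_wpM2l K0 l2; lra.
rewrite /edge_l1 /edge_l2 !mulr_sumr -big_split /=.
apply: le_trans (ler_norm_sum _ _ _) _; apply: ler_sum => p _.
rewrite subrr !sub0r normrN sqrrN /T.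
have := expR_taylor2_ge0 (g p.2 - g p.1); rewrite -/(r p) => r0.
have := expR_taylor2_le (gM p.1 p.2); rewrite -/(r p).
set d := g p.2 - g p.1 => r_le.
have /andP[_ m2] := mb p.1.
have Rp := rate0 p.1 p.2.
have T1 : `|e * nu p.1 * rate p.1 p.2 * d * (psi p.2 - psi p.1)| <=
    total_nu * D * (`|e| * (rate p.1 p.2 * `|d|)).
  rewrite !normrM (ger0_norm Rp).
  have -> : `|e| * `|nu p.1| * rate p.1 p.2 * `|d| * `|psi p.2 - psi p.1| =
    `|nu p.1| * `|psi p.2 - psi p.1| * (`|e| * (rate p.1 p.2 * `|d|)) by ring.
  by rewrite ler_wpM2r ?mulr_ge0 // ler_pM.
have Rr : rate p.1 p.2 * r p <= expR M * (rate p.1 p.2 * d ^+ 2).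
  by rewrite mulrCA ler_wpM2l.
have Rr0 : 0 <= rate p.1 p.2 * r p by rewrite mulr_ge0.
have T2 : `|perturb pi e nu p.1 * rate p.1 p.2 * r p * (psi p.2 - psi p.1)| <=
    2 * D * expR M * (rate p.1 p.2 * d ^+ 2).
  rewrite !normrM (ger0_norm (m0 _)) (ger0_norm Rp) (ger0_norm r0).
  rewrite -(mulrA _ (rate _ _)) mulrAC -(mulrA (2 * D)).
  by rewrite ler_pM ?mulr_ge0 // ler_pM.
have T3 : `|nu p.1 * rate p.1 p.2 * r p| <= total_nu * expR M * (rate p.1 p.2 * d ^+ 2).
  by rewrite -mulrA normrM (ger0_norm Rr0) -mulrA ler_pM.
apply: le_trans (ler_normD _ _) _; apply: le_trans (lerD (ler_normD _ _) (lexx _)) _.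
lra.
Qed.

Lemma DV_second_variation psi :
  (forall h, dirichlet rate pi psi h = - \sum_x nu x * generator rate h x) ->
  is_second_variation rate pi nu nu (dirichlet rate pi psi psi).
Proof.
move=> psiE.
have [a [d [M [a0 d0 mb gex bound]]]] := perturb_maximizers.
have pert0 : perturb pi 0 nu = pi by apply/funext => x; rewrite /perturb mul0r addr0.
(* Maximizers are determined only up to constants, so the choice at [e = 0] is pinned to the zero
   function; beyond [d] the value is arbitrary. *)
have maximizer e : exists g,
    (`|e| <= d -> dv_maximizer rate (perturb pi e nu) g) /\ (e = 0 -> g = fun=> 0).
  have [->|e0] := eqVneq e 0.
    by exists (fun=> 0); rewrite pert0; split=> // _; exact: dv_maximizer_stationary.
  have [/gex[g gmax]|_] := boolP (`|e| <= d); last by exists (fun=> 0); split.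
  by exists g; split=> // eE; rewrite eE eqxx in e0.
have [G GP] := boolp.choice maximizer.
have Gmax e := (GP e).1.
have [C C0 stab] := dv_maximizer_stable M a0.
exists (fun e => dv_action rate nu (G e)).
  near=> e; apply: (DV_first_variation a0 mb bound Gmax).
  by near: e; exact: (@nbhs0_lt R R).
have -> : dv_action rate nu (G 0) = 0 by rewrite (GP 0).2 // dv_action0.
pose D := \sum_p `|psi p.2 - psi p.1|.
have psiD x y : `|psi y - psi x| <= D.
  by rewrite /D (bigD1 (x, y)) //= lerDl sumr_ge0.
apply: (@cvg_dnbhs0_lipschitz _ _ _
  ((total_nu * D + (2 * D + total_nu) * expR M) * C)); near=> e.
have e0 : e != 0 by near: e; exact: nbhs_dnbhs_neq.
have ed : `|e| <= d by near: e; exact: dnbhs0_le.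
have d00 : `|0 : R| <= d by rewrite normr0 ltW.
have lo x s : `|s| <= d -> a <= perturb pi s nu x by move=> /mb /(_ x) /andP[].
have := stab _ _ _ _ (fun x => lo x _ d00) (fun x => lo x _ ed)
  (bound _ _ d00 (Gmax _ d00)) (bound _ _ ed (Gmax _ ed)) (Gmax _ d00) (Gmax _ ed).
rewrite (GP 0).2 // subr0 => -[l2 l1].
have := dv_action_expansion a0 (mb _ ed) (bound _ _ ed (Gmax _ ed)) (Gmax _ ed) psiE psiD l2 l1.
move=> H; rewrite subr0.
have -> : e^-1 * dv_action rate nu (G e) - dirichlet rate pi psi psi =
  (dv_action rate nu (G e) - e * dirichlet rate pi psi psi) / e by field.
rewrite normrM normfV ler_pdivrMr ?normr_gt0 //.
by rewrite -(mulrA _ `|e|) -expr2 real_normK // num_real.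
Unshelve. all: by end_near. Qed.

Lemma variational_formula psi :
  (forall h, dirichlet rate pi psi h = - \sum_x nu x * generator rate h x) ->
  (dirichlet rate pi psi psi)%:E =
  ereal_sup [set (2 * dotp pi (fun x => nu x / pi x) h
                  - asymptotic_variance rate pi h)%:E | h in [set h | mean_zero pi h]].
Proof.
move=> psiE.
(* Completion of the square, with [g] the solution of L g = h. *)
have valE h : mean_zero pi h -> let g := inv_generator rate pi h in
    2 * dotp pi (fun x => nu x / pi x) h - asymptotic_variance rate pi h =
    dirichlet rate pi psi psi
    - dirichlet rate pi (fun x => psi x + g x) (fun x => psi x + g x).
  move=> h0 g; rewrite asymptotic_varianceE // -/g dirichletD psiE.
  have -> : dotp pi (fun x => nu x / pi x) h = \sum_x nu x * generator rate g x.
    rewrite (inv_generatorP rate0 irr stat h0).2; apply: eq_bigr => x _.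
    by rewrite mulrCA divff ?mulr1 // gt_eqF.
  by rewrite !psiE; ring.
apply/eqP; rewrite eq_le; apply/andP; split; last first.
  apply: ge_ereal_sup => _ [h h0 <-]; rewrite lee_fin valE //.
  by rewrite gerBl dirichlet_ge0.
(* The optimal [h]: the solution [g] is then [- psi] up to a constant, and the subtracted square
   vanishes. *)
pose h := generator rate (fun x => - psi x).
have h0 : mean_zero pi h by exact: generator_mean_zero.
apply: ereal_sup_ubound; exists h => //; rewrite valE //; congr EFin.
rewrite -[RHS]subr0; congr (_ - _).
have const := generator_eq0_const rate0 irr stat.
set g := inv_generator rate pi h.
have gC : forall x y, psi x + g x = psi y + g y.
  apply: const; have := (inv_generatorP rate0 irr stat h0).2; rewrite -/g.
  have -> : (fun x => psi x + g x) = (fun x => g x - - psi x).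
    by apply/funext => x; rewrite opprK addrC.
  by rewrite generatorB => ->; apply/funext => x; rewrite /h subrr.
by rewrite /dirichlet big1 // => p _; rewrite (gC p.2 p.1) subrr !mulr0.
Qed.

End Perturbation.

(** * Dependence on the rates through the generator alone, and conclusion *)

Section CongrGenerator.
Context {R : realType} {V : finType} (r rate : V -> V -> R)
  (eq_gen : generator r = generator rate).

Lemma eq_is_second_variation : is_second_variation r = is_second_variation rate.
Proof.
by rewrite /is_second_variation /is_first_variation /DV eq_gen.
Qed.

Lemma eq_asymptotic_variance : asymptotic_variance r = asymptotic_variance rate.
Proof.
by rewrite /asymptotic_variance /sym_generator /inv_generator eq_gen.
Qed.

End CongrGenerator.

Theorem mainTheorem8 (R : realType) (V : finType) (rate : V -> V -> R)
    (pi nu : V -> R)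
    (rate_ge0 : jump_rates rate)
    (rate_irr : irreducible rate)
    (pi_stat : stationary rate pi)
    (nu_mass0 : \sum_x nu x = 0) :
  let f := fun x => nu x / pi x in
  exists l : R,
    is_second_variation rate pi nu nu l /\
    l%:E = ereal_sup [set (2 * dotp pi f h - asymptotic_variance rate pi h)%:E
                     | h in [set h | mean_zero pi h]].
Proof.
move=> f.
(* The diagonal of [rate] may be negative; setting it to 0 keeps the generator and makes all rates
   nonnegative, as the preceding sections assume. *)
pose r x y := if x == y then 0 else rate x y.
have eq_gen : generator r = generator rate.
  apply/funext => g; apply/funext => x; apply: eq_bigr => y _.
  by rewrite /r; case: eqVneq => // ->; rewrite subrr !mulr0.
have r0 x y : 0 <= r x y by rewrite /r; case: eqVneq => // /rate_ge0.
have r_irr : irreducible r.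
  by apply: sub_irreducible rate_irr => x y /negbTE xy; rewrite /r xy.
have r_stat : stationary r pi by rewrite /stationary eq_gen.
have [psi psiE] := dirichlet_representation nu r0 r_irr r_stat.
exists (dirichlet r pi psi psi).
rewrite -(eq_is_second_variation eq_gen) -(eq_asymptotic_variance eq_gen); split.
  exact: DV_second_variation.
exact: variational_formula.
Qed.
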